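(* Let $D$ be a discrete tree-based fractal specification (for example an IFS-generated tree or a turtle-interpreted L-system), with rooted tree $T_D=(\mathcal N_D,\mathcal E_D)$ and per-branch parameters. Then there exists an analytic fractal tree $T$ whose induced discrete scaffold is combinatorially identical to $T_D$ at every finite depth: for every integer $k\ge 0$, the truncation to depth at most $k$ of the induced discrete scaffold of $T$ is isomorphic, as a rooted tree, to the truncation of $T_D$ to depth at most $k$. Moreover, if $D$ comes with an embedded realization of its nodes in $\mathbb R^d$, that is, a map $p:\mathcal N_D\to\mathbb R^d$ giving the locations of the nodes, then the analytic fractal tree $T$ (with realized geometry in $\mathbb R^d$) may be chosen so that its branchpoints coincide with these node locations at every finite stage: for each node $v\in\mathcal N_D$, the branchpoint of $T$ at the scaffold node corresponding to $v$ is $p(v)$.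
   Context: Discrete specification. A discrete tree-based fractal specification $D$ determines a rooted tree $T_D=(\mathcal N_D,\mathcal E_D)$, with edges directed from parent to child and each node having finitely many children, together with parameters attached to the edges (e.g. contraction ratios in $(0,1)$ and orientation labels). The depth of a node is its distance from the root. Analytic fractal tree. Fix integers $n,d\ge 1$, an internal state space $\mathbb R^n$, and a real-analytic realization map $\Pi:\mathbb R^n\to\mathbb R^d$ (typically a coordinate projection). For an open interval $J\subset\mathbb R$, an analytic generator field is a real-analytic map $V:J\times\mathbb R^n\to\mathbb R^n$; a realization of it is a solution $X$ of $\frac{dX}{ds}=V(s,X)$, and its realized curve is $\gamma(s)=\Pi(X(s))$. An analytic fractal tree $T$ with realized geometry in $\mathbb R^d$ consists of ($n$ and $\Pi$ being part of the choice): a rooted tree $(\mathcal N,\mathcal E)$ in which every node has finitely many children; a root state $X_0\in\mathbb R^n$; and, for each edge $e=(u\to v)\in\mathcal E$, a number $S_e>0$, an open interval $J_e\supset[0,S_e]$, an analytic generator field $V_e:J_e\times\mathbb R^n\to\mathbb R^n$ and a realization $X_e:[0,S_e]\to\mathbb R^n$ of $V_e$ (a branch), satisfying exact state inheritance with no offset: $X_e(0)=X_0$ if $u$ is the root, and $X_e(0)=X_{e'}(S_{e'})$ if $e'$ is the edge ending at $u$. Different branches may carry different generator fields. Branchpoints and induced discrete scaffold. The branchpoint at the root is $q(\mathrm{root})=\Pi(X_0)$, and the branchpoint at a node $v$ with incoming edge $e$ is $q(v)=\Pi(X_e(S_e))$. The induced discrete scaffold of $T$ is the rooted tree $(\mathcal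 N,\mathcal E)$ with each node $v$ located at the point $q(v)\in\mathbb R^d$. *)

(* Defs.v *)
From HB Require Import structures.
From mathcomp Require Import all_boot all_order all_algebra finmap.
From mathcomp Require Import all_classical all_reals all_analysis.
From mathcomp.analysis Require Import showcase.summability.
Import Order.TTheory GRing.Theory Num.Theory numFieldNormedType.Exports.

Set Implicit Arguments.
Unset Strict Implicit.
Unset Printing Implicit Defensive.

Local Open Scope classical_set_scope.
Local Open Scope ring_scope.

(* [walk E r k v]: some directed walk with exactly [k] edges joins r to v. *)
Inductive walk (N : Type) (E : set (N * N)) (r : N) : nat -> N -> Prop :=
| walk0 : walk E r 0 r
| walkS k u v : walk E r k u -> E (u, v) -> walk E r k.+1 v.

Record rooted_tree := RootedTree {
  node : Type;
  edge : set (node * node);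
  tree_root : node;
  root_orphan : forall u, ~ edge (u, tree_root);
  parent_unique : forall u u' v, edge (u, v) -> edge (u', v) -> u = u';
  tree_reachable : forall v, exists k, walk edge tree_root k v;
  finite_children : forall u, finite_set [set v | edge (u, v)]
}.
Arguments edge : clear implicits.
Arguments tree_root : clear implicits.

Definition branch (T : rooted_tree) : Type := set_type (edge T).
Definition src (T : rooted_tree) (e : branch T) : node T := (val e).1.
Definition tgt (T : rooted_tree) (e : branch T) : node T := (val e).2.

Lemma tgt_inj (T : rooted_tree) : injective (@tgt T).
Proof.
move=> [[u v] uv] [[u' v'] uv']; rewrite /tgt/= => vv'; subst v'.
apply: val_inj => /=; congr (_, _).
by move: uv uv' => /set_mem uv /set_mem uv'; exact: parent_unique uv uv'.
Qed.

Lemma ex_walk (T : rooted_tree) (v : node T) :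
  exists k, `[< walk (edge T) (tree_root T) k v >].
Proof. by have [k vk] := tree_reachable v; exists k; apply/asboolP. Qed.

Definition depth (T : rooted_tree) (v : node T) : nat := ex_minn (ex_walk v).

Lemma depth_root (T : rooted_tree) : depth (tree_root T) = 0%N.
Proof.
rewrite /depth; case: ex_minnP => k _ /(_ 0%N) kmin.
by apply/eqP; rewrite -leqn0 kmin//; apply/asboolP/walk0.
Qed.

Lemma depth_edge (T : rooted_tree) (u v : node T) :
  edge T (u, v) -> depth v = (depth u).+1.
Proof.
move=> uv; rewrite /depth; case: ex_minnP => k /asboolP kv kmin.
case: ex_minnP => l /asboolP lu lmin.
have kl : (k <= l.+1)%N by apply: kmin; apply/asboolP/(walkS lu).
case: kv uv kl {kmin} => [/root_orphan//|{}k u' v' ku' u'v' uv' kl].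
apply/eqP; rewrite eqn_leq kl ltnS/= lmin//; apply/asboolP.
by rewrite (parent_unique uv' u'v').
Qed.

Section truncation.
Variables (k : nat) (T : rooted_tree).

Definition tnode : Type := {v : node T | (depth v <= k)%N}.

Definition tedge : set (tnode * tnode) :=
  [set e | edge T (val e.1, val e.2)].

Lemma troot_subproof : (depth (tree_root T) <= k)%N.
Proof. by rewrite depth_root. Qed.

Definition troot : tnode := exist _ (tree_root T) troot_subproof.

Lemma troot_orphan u : ~ tedge (u, troot).
Proof. exact: root_orphan. Qed.

Lemma tparent_unique u u' v : tedge (u, v) -> tedge (u', v) -> u = u'.
Proof. by move=> uv u'v; apply: val_inj; exact: parent_unique uv u'v. Qed.

Lemma treachable v : exists n, walk tedge troot n v.
Proof.
case: v => v vk; have [n nv] := tree_reachable v; exists n.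
elim: nv vk => [|{}n u {}v _ IH uv] vk.
  by rewrite (_ : exist _ _ _ = troot); [exact: walk0|exact: val_inj].
have uk : (depth u <= k)%N by rewrite (leq_trans _ vk)// (depth_edge uv).
exact: (walkS (IH uk)).
Qed.

Lemma tfinite_children u : finite_set [set v | tedge (u, v)].
Proof.
have /finite_preimage : finite_set [set v | edge T (val u, v)].
  exact: finite_children.
by move=> /(_ _ (val : tnode -> node T)); apply; apply: in2W; exact: val_inj.
Qed.

Definition truncation : rooted_tree :=
  RootedTree troot_orphan tparent_unique treachable tfinite_children.

End truncation.

Definition tree_iso (A B : rooted_tree) (f : node A -> node B) : Prop :=
  [/\ bijective f,
      f (tree_root A) = tree_root B
    & forall u v, edge A (u, v) <-> edge B (f u, f v)].

Definition tree_isomorphic (A B : rooted_tree) : Prop :=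
  exists f : node A -> node B, tree_iso f.

(* The node correspondence [f] restricts to an isomorphism between the
   truncations to depth at most [k]. *)
Definition iso_to_depth (k : nat) (A B : rooted_tree) (f : node A -> node B) :
    Prop :=
  exists2 g : node (truncation k A) -> node (truncation k B),
    tree_iso g & forall v, val (g v) = f (val v).

(* The edge parameters (contraction ratios, orientation labels, ...) range over
   an arbitrary type. *)
Record discrete_spec := DiscreteSpec {
  spec_tree :> rooted_tree;
  branch_param : Type;
  param : branch spec_tree -> branch_param
}.

Record located_tree (R : realType) (d : nat) := LocatedTree {
  located_shape :> rooted_tree;
  location : node located_shape -> 'rV[R]_d
}.

Section analytic.
Variable R : realType.

(* Around each point of [U], f is the sum of a power series in m variables,
   with vector coefficients indexed by the multi-indices a : {ffun 'I_m -> nat}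
   and summed unconditionally (along the net of finite sets of multi-indices). *)
Definition real_analytic (m k : nat) (U : set 'rV[R]_m)
    (f : 'rV[R]_m -> 'rV[R]_k) : Prop :=
  forall x, U x -> exists c : {ffun 'I_m -> nat} -> 'rV[R]_k,
    nbhs x [set y : 'rV[R]_m |
      partial_sum (fun a : {ffun 'I_m -> nat} =>
        (\prod_(i < m) (y ord0 i - x ord0 i) ^+ a i) *: c a) @ totally --> f y].

(* J x R^n is identified with the set of row vectors of length 1 + n whose
   first entry is in J. *)
Definition analytic_generator_field (n : nat) (J : set R)
    (V : R -> 'rV[R]_n -> 'rV[R]_n) : Prop :=
  real_analytic [set y : 'rV[R]_(1 + n) | J (lsubmx y ord0 ord0)]
    (fun y => V (lsubmx y ord0 ord0) (rsubmx y)).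

(* The derivative is taken within [0, S], hence is one-sided at the endpoints;
   the values of [X] outside [0, S] are irrelevant. *)
Definition realization (n : nat) (V : R -> 'rV[R]_n -> 'rV[R]_n) (S : R)
    (X : R -> 'rV[R]_n) : Prop :=
  forall s : R, `[0, S]%classic s ->
    (t - s)^-1 *: (X t - X s) @[t --> within `[0, S]%classic s^']
      --> V s (X s).

Record analytic_fractal_tree (d : nat) := AnalyticFractalTree {
  shape :> rooted_tree;
  state_dim : nat;
  state_dim_gt0 : (0 < state_dim)%N;
  Pi : 'rV[R]_state_dim -> 'rV[R]_d;
  Pi_analytic : real_analytic setT Pi;
  root_state : 'rV[R]_state_dim;
  duration : branch shape -> R;
  duration_gt0 : forall e, 0 < duration e;
  time_domain : branch shape -> set R;
  time_domain_open : forall e, open (time_domain e);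
  time_domain_interval : forall e, is_interval (time_domain e);
  time_domain_sub : forall e, `[0, duration e]%classic `<=` time_domain e;
  generator : branch shape -> R -> 'rV[R]_state_dim -> 'rV[R]_state_dim;
  generator_analytic : forall e,
    analytic_generator_field (time_domain e) (generator e);
  traj : branch shape -> R -> 'rV[R]_state_dim;
  traj_realization : forall e, realization (generator e) (duration e) (traj e);
  root_inheritance : forall e, src e = tree_root shape -> traj e 0 = root_state;
  edge_inheritance : forall e e', tgt e' = src e ->
    traj e 0 = traj e' (duration e')
}.

(* The root is the only node without incoming edge. *)
Definition node_state (d : nat) (T : analytic_fractal_tree d) (v : node T) :
    'rV[R]_(state_dim T) :=
  match pselect (exists e : branch T, tgt e = v) with
  | left ex_e => let e := projT1 (cid ex_e) in traj e (duration e)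
  | right _ => root_state T
  end.

Definition branchpoint (d : nat) (T : analytic_fractal_tree d) (v : node T) :
    'rV[R]_d := Pi (node_state v).

Lemma branchpoint_root (d : nat) (T : analytic_fractal_tree d) :
  branchpoint (tree_root T) = Pi (root_state T).
Proof.
rewrite /branchpoint /node_state; case: pselect => //= -[[[u v] uv]].
by rewrite /tgt/= => vr; case: (root_orphan (u := u)); rewrite -vr; exact: set_mem.
Qed.

Lemma branchpoint_tgt (d : nat) (T : analytic_fractal_tree d) (e : branch T) :
  branchpoint (tgt e) = Pi (traj e (duration e)).
Proof.
rewrite /branchpoint /node_state; case: pselect => [ex_e|]; last by case; exists e.
by case: (cid ex_e) => e' /= /tgt_inj ->.
Qed.

Definition scaffold (d : nat) (T : analytic_fractal_tree d) : located_tree R d :=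
  LocatedTree (@branchpoint d T).

End analytic.

(* Main.v *)
Require Import Defs.
From mathcomp Require Import all_boot all_order all_algebra finmap.
From mathcomp Require Import all_classical all_reals all_analysis.
From mathcomp.analysis Require Import showcase.summability.
Import Order.TTheory GRing.Theory Num.Theory numFieldNormedType.Exports.

(* Take state space R^d, the identity realization, and let each branch run at
   constant velocity along the segment joining the prescribed locations of its
   two end nodes; the generators and the realization map are then affine, hence
   equal to power series with finitely many terms. *)

Set Implicit Arguments.
Unset Strict Implicit.
Unset Printing Implicit Defensive.

Local Open Scope classical_set_scope.
Local Open Scope ring_scope.

Lemma sum_fset_delta (I : choiceType) (V : nmodType) (B : {fset I}) (a : I)
    (F : I -> V) : a \in B ->
  \sum_(i : B) (if val i == a then F (val i) else 0) = F a.
Proof.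
by move=> aB; rewrite -big_mkcond/= (big_pred1 [` aB]%fset).
Qed.

(** Since [b + y *m A] is [b + x *m A] plus the sum of the [(y - x) ord0 i *: row i A], the
    expansion at [x] stops in degree one and is valid for all [y]. *)
Lemma real_analytic_affine (R : realType) (m k : nat) (U : set 'rV[R]_m)
    (b : 'rV[R]_k) (A : 'M[R]_(m, k)) :
  real_analytic U (fun y => b + y *m A).
Proof.
move=> x _.
pose e0 : {ffun 'I_m -> nat} := [ffun=> 0%N].
pose e i : {ffun 'I_m -> nat} := [ffun j => nat_of_bool (j == i)].
(* [e0] and [e i] are the exponents of the constant and of the [i]-th linear monomial. Writing the
   coefficient as a sum of deltas lets [sum_fset_delta] collapse each contribution separately. *)
exists (fun a => (if a == e0 then b + x *m A else 0) +
  \sum_(i < m) (if a == e i then row i A else 0)).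
apply: filterE => y /=.
apply: cvg_near_cst; first exact/filter_filter/totally_filter.
(* Every finite set containing all these exponents gives the same partial sum, so the net is
   eventually constant. *)
exists (e0 |` [fset e i | i : 'I_m])%fset => // B /=.
rewrite fsubUset fsub1set => /andP[e0B /fsubsetP eB].
rewrite /partial_sum; pose P (a : {ffun 'I_m -> nat}) :=
  \prod_(i < m) (y ord0 i - x ord0 i) ^+ a i.
transitivity (\sum_(a : B) ((if val a == e0 then P (val a) *: (b + x *m A) else 0) +
    \sum_(i < m) (if val a == e i then P (val a) *: row i A else 0))).
  apply: eq_bigr => a _; rewrite scalerDr scaler_sumr; congr (_ + _).
    by case: ifP; rewrite ?scaler0.
  by apply: eq_bigr => i _; case: ifP; rewrite ?scaler0.
rewrite big_split/= (sum_fset_delta (fun a => P a *: _))// exchange_big/=.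
have -> : P e0 = 1 by rewrite /P big1// => i _; rewrite ffunE.
rewrite scale1r (eq_bigr (fun i => (y - x) ord0 i *: row i A)) => [|i _].
  by rewrite -mulmx_sum_row mulmxBl -addrA subrKC.
rewrite (sum_fset_delta (fun a => P a *: _)); last first.
  by apply: eB; apply/imfsetP; exists i.
congr (_ *: _); rewrite /P (bigD1 i)//= big1 => [|j /negPf ji]; rewrite ffunE.
  by rewrite eqxx expr1 mulr1 !mxE.
by rewrite ji.
Qed.

Lemma real_analytic_cst (R : realType) (m k : nat) (U : set 'rV[R]_m)
    (b : 'rV[R]_k) : real_analytic U (fun=> b).
Proof.
have := @real_analytic_affine R m k U b 0.
by under eq_fun do rewrite mulmx0 addr0.
Qed.

Lemma real_analytic_id (R : realType) (m : nat) (U : set 'rV[R]_m) :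
  real_analytic U id.
Proof.
have := @real_analytic_affine R m m U 0 1%:M.
by under eq_fun do rewrite mulmx1 add0r.
Qed.

(** The difference quotient equals [w] at every [t] distinct from [s], so the endpoints of the
    interval need no separate treatment. *)
Lemma realization_line (R : realType) (n : nat) (S : R) (u w : 'rV[R]_n) :
  realization (fun _ _ => w) S (fun s => u + s *: w).
Proof.
move=> s _; apply: cvg_near_cst; apply: cvg_within.
apply: filterS (nbhs_dnbhs_neq s) => t ts.
by rewrite [u + _]addrC addrKA -scalerBl scalerA mulVf ?scale1r// subr_eq0.
Qed.

Section straight_tree.
Variables (R : realType) (d : nat) (hd : (0 < d)%N) (T : rooted_tree).
Variable p : node T -> 'rV[R]_d.

(** With unit durations the velocity is the displacement between the end nodes. The term is kept
    transparent so that branchpoints can be computed from it. *)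
Definition straight_tree : analytic_fractal_tree R d.
Proof.
pose vel (e : branch T) := p (tgt e) - p (src e).
refine (@AnalyticFractalTree R d T d hd id _ (p (tree_root T))
  (fun=> 1) _ (fun=> setT) _ _ _ (fun e _ _ => vel e) _
  (fun e s => p (src e) + s *: vel e) _ _ _).
- exact: real_analytic_id.
- by move=> _; exact: ltr01.
- by move=> _; exact: openT.
- by move=> _ ? ? ? ?.
- by move=> _ ? ?.
- by move=> e; exact: real_analytic_cst.
- by move=> e; exact: realization_line.
- by move=> e ->; rewrite scale0r addr0.
- by move=> e e' <-; rewrite scale0r addr0 scale1r subrKC.
Defined.

Lemma branchpoint_straight_tree (v : node T) :
  branchpoint (v : node straight_tree) = p v.
Proof.
rewrite /branchpoint /node_state; case: pselect => [ex_e|nex_e] /=.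
  by case: (cid ex_e) => e /= <-; rewrite scale1r subrKC.
(* A node without incoming edge is the root: a nonempty walk reaching it would end with such an
   edge. *)
have [k rv] := tree_reachable v; case: rv nex_e => // {}k u w _ uw nex_e.
by case: nex_e; exists (exist _ (u, w) (mem_set uw)).
Qed.

End straight_tree.

Lemma tree_iso_id (T : rooted_tree) : @tree_iso T T id.
Proof. by split => //; exists id. Qed.

Theorem theorem1 (R : realType) (d : nat) (hd : (0 < d)%N) (D : discrete_spec) :
  (exists T : analytic_fractal_tree R d,
     forall k : nat,
       tree_isomorphic (truncation k (scaffold T)) (truncation k D)) /\
  (forall p : node D -> 'rV[R]_d,
     exists (T : analytic_fractal_tree R d) (f : node D -> node (scaffold T)),
       (forall k : nat, iso_to_depth k f) /\
       (forall v : node D, branchpoint (f v) = p v)).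
Proof.
split=> [|p].
  (* Any locations would do here. The scaffold has the tree of [D] itself as its shape, hence the
     identity. *)
  by exists (straight_tree hd (fun _ : node D => 0)) => k; exists id; exact: tree_iso_id.
exists (straight_tree hd p), id; split=> [k|v].
  by exists id => //; exact: tree_iso_id.
exact: branchpoint_straight_tree.
Qed.
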